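(* Let $\mathcal{A}$ be a $U(\mathfrak{g})$-invariant commutative algebra and let $\mathcal{A}_h$ be a $U_h(\mathfrak{g})$-invariant quantization of $\mathcal{A}$, with multiplication $\mu_h=\mu+h\mu_1+o(h)$. Then the corresponding Poisson bracket $\{a,b\}=\mu_1(a,b)-\mu_1(b,a)$ has the form $$\{a,b\}=f(a,b)-\{a,b\}_r ,\qquad a,b\in\mathcal{A},$$ where $f$ is a $U(\mathfrak{g})$-invariant bracket on $\mathcal{A}$. Moreover, the brackets $f$ and $\{\cdot,\cdot\}_r$ are compatible, and $[\![f,f]\!]=-\varphi_{\mathcal{A}}$.
   Context: $\mathfrak{g}$ is a finite-dimensional complex semisimple Lie algebra and $r\in\wedge^2\mathfrak{g}$ is a classical $r$-matrix, i.e. $\varphi:=[\![r,r]\!]\in\wedge^3\mathfrak{g}$ (Schouten bracket) is $\mathfrak{g}$-invariant. The Lie bialgebra is $(\mathfrak{g},r)$ with cobracket $\delta(x)=[r,\Delta(x)]$, $\Delta$ being the usual comultiplication of $U(\mathfrak{g})$. $U_h(\mathfrak{g})$ is a quantum group quantizing $(\mathfrak{g},r)$: a topological Hopf algebra over $\mathbb{C}[[h]]$ that is isomorphic to $U(\mathfrak{g})[[h]]$ as a topological $\mathbb{C}[[h]]$-algebra (we fix this identification), reduces modulo $h$ to the Hopf algebra $U(\mathfrak{g})$, and has comultiplication $\Delta_h=\Delta+h\Delta_1+o(h)$ with $\Delta_1-\sigma\Delta_1=\delta$ on $\mathfrak{g}$, where $\sigma$ is the flip; $\Delta_h(x)=F_h\Delta(x)F_h^{-1}$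 with $F_h=1\otimes1+\frac h2 r+o(h)\in U(\mathfrak{g})^{\otimes 2}[[h]]$. A $U(\mathfrak{g})$-invariant commutative algebra is a commutative associative algebra $\mathcal{A}$ that is a $U(\mathfrak{g})$-module with multiplication $\mu$ satisfying $x\mu(a\otimes b)=\mu\Delta(x)(a\otimes b)$. A quantization $\mathcal{A}_h$ of $\mathcal{A}$ is an associative $\mathbb{C}[[h]]$-algebra isomorphic to $\mathcal{A}[[h]]$ as a $\mathbb{C}[[h]]$-module, with multiplication $\mu_h=\mu+h\mu_1+o(h)$. It is $U_h(\mathfrak{g})$-invariant if $x\mu_h(a\otimes b)=\mu_h\Delta_h(x)(a\otimes b)$ for $x\in U(\mathfrak{g})$, $a,b\in\mathcal{A}$ (with $U(\mathfrak{g})[[h]]$ acting on $\mathcal{A}[[h]]$ by $\mathbb{C}[[h]]$-linear extension). A bracket on $\mathcal{A}$ is a skew-symmetric bilinear map $\mathcal{A}\otimes\mathcal{A}\to\mathcal{A}$ satisfying the Leibniz rule in each argument. A bracket $f$ is $U(\mathfrak{g})$-invariant if $xf(a\otimes b)=f\Delta(x)(a\otimes b)$. The $r$-matrix bracket is $\{a,b\}_r=\mu r(a\otimes b)=(r_1a)(r_2b)$, where $r=r_1\otimes r_2$ (summation implicit). The Schouten bracket of brackets $f,g$ is $$[\![f,g]\!](a,b,c)=f(g(a,b),c)+g(f(a,b),c)+\text{cyclic permutations of }a,b,c,$$ and $f,g$ are compatible if $[\![f,g]\!]=0$. Finally $\varphi_{\mathcal{A}}(a,b,c)=(\varphi_1a)(\varphi_2b)(\varphi_3c)$,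 where $\varphi=\varphi_1\otimes\varphi_2\otimes\varphi_3$ (summation implicit). The Schouten bracket on $\wedge^\bullet\mathfrak{g}$ is normalized compatibly with the one on brackets, i.e. so that the Schouten bracket of $\{\cdot,\cdot\}_r$ with itself is $\varphi_{\mathcal{A}}$. *)

(* Defs.v *)
From HB Require Import structures.
From mathcomp Require Import all_boot all_order all_algebra.
From mathcomp Require Import generic_quotient.
From mathcomp Require Import boolp classical_sets.
From mathcomp Require Import complex reals.

Set Implicit Arguments.
Unset Strict Implicit.
Unset Printing Implicit Defensive.

Import Order.TTheory GRing.Theory Num.Theory.
Local Open Scope ring_scope.
Local Open Scope quotient_scope.

Section LinearFacts.
Variables (K : fieldType) (U V W : lmodType K).

Lemma linear_add (f : U -> V) : linear f -> {morph f : u v / u + v}.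
Proof. by move=> lf u v; rewrite -[u]scale1r lf !scale1r. Qed.

Lemma linear_0 (f : U -> V) : linear f -> f 0 = 0.
Proof. by move=> /linear_add fD; apply: (addIr (f 0)); rewrite -fD !add0r. Qed.

Lemma linear_scale (f : U -> V) : linear f -> forall a, {morph f : u / a *: u}.
Proof. by move=> lf a u; have := lf a u 0; rewrite (linear_0 lf) !addr0. Qed.

Lemma linear_opp (f : U -> V) : linear f -> {morph f : u / - u}.
Proof. by move=> lf u; rewrite -scaleN1r (linear_scale lf) scaleN1r. Qed.

Lemma linear_comp (f : U -> V) (g : V -> W) :
  linear f -> linear g -> linear (fun u => g (f u)).
Proof. by move=> lf lg a u v; rewrite lf lg. Qed.

(* Over a field, a nonzero vector is sent to 1 by some linear functional. *)
Lemma exists_functional (a : U) :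
  a != 0 -> exists2 phi : U -> K^o, linear phi & phi a = 1.
Proof.
move=> a0.
pose sub (G : set (U * K)) :=
  [/\ forall c x y, G x -> G y -> G (c *: x.1 + y.1, c * x.2 + y.2)
    & forall k, G (0, k) -> k = 0].
pose base : set (U * K) := fun p => exists c, p = (c *: a, c).
have sbase : sub base.
  split=> [c _ _ [x ->] [y ->]|k [c [e ->]]] /=.
    by exists (c * x + y); rewrite scalerDl scalerA.
  by move/esym/eqP: e; rewrite scaler_eq0 (negPf a0) orbF => /eqP.
have [|G [[lG fG] Gmax]] := @Zorn_bigcup (U * K)%type
    (fun G => sub (G `|` base)%classic).
  move=> F FP Ftot /=; split.
    move=> c x y; have [[X0 FX0]|noX] := pselect (exists X, F X); last first.
      move=> [[X FX _]|bx]; first by case: noX; exists X.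
      move=> [[X FX _]|by_]; first by case: noX; exists X.
      by right; apply: sbase.1.
    have mk z : ((\bigcup_(X in F) X) `|` base)%classic z ->
        exists2 X, F X & (X `|` base)%classic z.
      by case=> [[X FX Xz]|bz]; [exists X => //; left | exists X0 => //; right].
    move=> /mk [X FX Xx] /mk [Y FY Yy].
    have [Z [FZ Zx Zy]] : exists Z, [/\ F Z, (Z `|` base)%classic x
        & (Z `|` base)%classic y].
      have [XY|YX] := Ftot X Y FX FY.
        by exists Y; split=> //; case: Xx; [left; apply: XY | right].
      by exists X; split=> //; case: Yy; [left; apply: YX | right].
    by case: ((FP _ FZ).1 c x y Zx Zy) => [Zz|bz]; [left; exists Z | right].
  move=> k [[X FX Xk]|bk]; last exact: sbase.2.
  by apply: (FP _ FX).2; left.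
set H := (G `|` base)%classic in lG fG.
have Hfun x k l : H (x, k) -> H (x, l) -> k = l.
  move=> Hk Hl; have := lG (-1) _ _ Hl Hk; rewrite /= scaleN1r addNr mulN1r.
  by move/fG/eqP; rewrite addrC subr_eq0 => /eqP.
have Ha : H (a, 1) by right; exists 1; rewrite scale1r.
have H0 : H (0, 0) by right; exists 0; rewrite scale0r.
have Htot x : exists k, H (x, k).
  have [//|nx] := pselect (exists k, H (x, k)); exfalso.
  pose B : set (U * K) :=
    fun p => exists q : U * K, exists c, H q /\ p = (c *: x + q.1, q.2).
  have HB : (H `<=` B)%classic.
    by move=> [u k] Hu; exists (u, k), 0; rewrite scale0r add0r.
  apply: (Gmax B).
    split; first by move=> p Gp; apply: HB; left.
    move=> BG; apply: nx; exists 0; left; apply: BG.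
    by exists (0, 0), 1; rewrite scale1r addr0.
  have -> : (B `|` base)%classic = B.
    by apply/seteqP; split=> p; [case=> // bp; apply: HB; right | left].
  split=> [c _ _ [p [d [Hp ->]]] [q [e [Hq ->]]]|k [[u l] [c [Hu [e ->]]]]] /=.
    exists (c *: p.1 + q.1, c * p.2 + q.2), (c * d + e).
    by split; [apply: lG | rewrite /= scalerDr scalerDl scalerA addrACA].
  have [c0|c0] := eqVneq c 0.
    by apply: fG; move: e; rewrite c0 scale0r add0r => ->.
  exfalso; apply: nx; exists (- c^-1 * l).
  have := lG (- c^-1) _ _ Hu H0; rewrite /= !addr0.
  suff -> : - c^-1 *: u = x by [].
  move/esym/eqP: e; rewrite addrC addr_eq0 => /eqP ->.
  by rewrite scalerN scaleNr opprK scalerA mulVf // scale1r.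
pose phi x : K^o := projT1 (cid (Htot x)).
have phiP x : H (x, phi x) by rewrite /phi; case: cid.
exists phi; last exact: Hfun (phiP a) Ha.
by move=> c u v; apply: Hfun (phiP _) _; exact: lG c _ _ (phiP u) (phiP v).
Qed.

End LinearFacts.

Notation bilinear2 f := (bilinear_for *:%R *:%R f).

Section Tensor.
Variables (K : fieldType) (U V : lmodType K).

Inductive tterm :=
  | TPure of U & V
  | TZero
  | TAdd of tterm & tterm
  | TScale of K & tterm.

HB.instance Definition _ := gen_eqMixin tterm.
HB.instance Definition _ := gen_choiceMixin tterm.

Fixpoint teval (W : lmodType K) (f : U -> V -> W) (t : tterm) : W :=
  match t with
  | TPure u v => f u v
  | TZero => 0
  | TAdd s t => teval f s + teval f t
  | TScale a t => a *: teval f t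
  end.

(* Two formal combinations of symbols u ⊗ v are identified iff every bilinear *)
(* map gives them the same value; the quotient is therefore the K-module with *)
(* the universal property of the tensor product (tlift, tlift_uniq below).    *)
Definition trel (s t : tterm) : bool :=
  `[< forall (W : lmodType K) (f : U -> V -> W), bilinear2 f ->
        teval f s = teval f t >].

Lemma trel_refl : reflexive trel. Proof. by move=> t; apply/asboolP. Qed.

Lemma trel_sym : symmetric trel.
Proof. by move=> s t; apply/asboolP/asboolP=> h W f /h. Qed.

Lemma trel_trans : transitive trel.
Proof.
by move=> t s u /asboolP h /asboolP k; apply/asboolP=> W f bf; rewrite h ?k.
Qed.

Canonical trel_equiv := EquivRel trel trel_refl trel_sym trel_trans.

Definition tensor := {eq_quot trel_equiv}.

HB.instance Definition _ := Choice.on tensor.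

Definition tpi (t : tterm) : tensor := \pi_tensor t.
Definition trepr (t : tensor) : tterm := repr t.

Lemma treprK t : tpi (trepr t) = t. Proof. exact: reprK. Qed.

Lemma tpiP s t : reflect (forall (W : lmodType K) (f : U -> V -> W),
  bilinear2 f -> teval f s = teval f t) (tpi s == tpi t).
Proof. by rewrite eqmodE; apply: asboolP. Qed.

Lemma teval_repr (W : lmodType K) (f : U -> V -> W) t :
  bilinear2 f -> teval f (trepr (tpi t)) = teval f t.
Proof.
by move=> bf; have /eqP/tpiP := treprK (tpi t); apply.
Qed.

Definition tzero := tpi TZero.
Definition tadd s t := tpi (TAdd (trepr s) (trepr t)).
Definition tscale a t := tpi (TScale a (trepr t)).
Definition topp := tscale (-1).

Let teqP s t : (forall (W : lmodType K) (f : U -> V -> W), bilinear2 f ->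
  teval f s = teval f t) -> tpi s = tpi t.
Proof. by move=> h; apply/eqP/tpiP. Qed.

Fact taddA : associative tadd.
Proof. by move=> s t u; apply: teqP => W f bf /=; rewrite !teval_repr //= addrA. Qed.
Fact taddC : commutative tadd.
Proof. by move=> s t; apply: teqP => W f bf /=; rewrite addrC. Qed.
Fact tadd0 : left_id tzero tadd.
Proof.
by move=> t; rewrite -[RHS]treprK; apply: teqP => W f bf /=; rewrite teval_repr //= add0r.
Qed.
Fact taddN : left_inverse tzero topp tadd.
Proof.
by move=> t; apply: teqP => W f bf /=; rewrite teval_repr //= scaleN1r addNr.
Qed.

HB.instance Definition _ := GRing.isZmodule.Build tensor taddA taddC tadd0 taddN.

Fact tscaleA a b t : tscale a (tscale b t) = tscale (a * b) t.
Proof. by apply: teqP => W f bf /=; rewrite teval_repr //= scalerA. Qed.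
Fact tscale1 : left_id 1 tscale.
Proof.
by move=> t; rewrite -[RHS]treprK; apply: teqP => W f bf /=; rewrite scale1r.
Qed.
Fact tscaleDr : right_distributive tscale +%R.
Proof.
move=> a s t; apply: teqP => W f bf /=.
by rewrite !teval_repr //= scalerDr.
Qed.
Fact tscaleDl t : {morph tscale^~ t : a b / a + b}.
Proof.
by move=> a b; apply: teqP => W f bf /=; rewrite !teval_repr //= scalerDl.
Qed.

HB.instance Definition _ :=
  GRing.Zmodule_isLmodule.Build K tensor tscaleA tscale1 tscaleDr tscaleDl.

Definition tpure (u : U) (v : V) : tensor := tpi (TPure u v).

(* The linear map u ⊗ v |-> f u v; meaningful when f is bilinear. *)
Definition tlift (W : lmodType K) (f : U -> V -> W) (t : tensor) : W :=
  teval f (trepr t).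

End Tensor.

Notation "U ⊗ V" := (tensor U%type V%type) (at level 40, left associativity) : type_scope.
Notation "u ⊗ v" := (tpure u v) (at level 40, left associativity) : ring_scope.

Section TensorTheory.
Variables (K : fieldType) (U V W : lmodType K).
Implicit Types (f : U -> V -> W) (t : (U ⊗ V)%type).

Lemma tpure_bilinear : bilinear2 (@tpure K U V).
Proof.
split=> [v a u u'|u a v v'] /=; apply/eqP/tpiP => X f bf /=;
  rewrite !teval_repr //= !teval_repr //=; [exact: bf.1|exact: bf.2].
Qed.

Lemma tpureDl (v : V) : {morph (fun u : U => u ⊗ v) : u u' / u + u'}.
Proof. exact: linear_add (tpure_bilinear.1 v). Qed.
Lemma tpureDr (u : U) : {morph (fun v : V => u ⊗ v) : v v' / v + v'}.
Proof. exact: linear_add (tpure_bilinear.2 u). Qed.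
Lemma tpureZl a (u : U) (v : V) : (a *: u) ⊗ v = a *: (u ⊗ v).
Proof. exact: (linear_scale (tpure_bilinear.1 v)). Qed.
Lemma tpureZr a (u : U) (v : V) : u ⊗ (a *: v) = a *: (u ⊗ v).
Proof. exact: (linear_scale (tpure_bilinear.2 u)). Qed.

Lemma tlift_linear f : bilinear2 f -> linear (tlift f).
Proof.
move=> bf a s t; rewrite /tlift teval_repr //=.
by rewrite -/(trepr (a *: s)) !teval_repr.
Qed.

Lemma tlift_pure f u v : bilinear2 f -> tlift f (u ⊗ v) = f u v.
Proof. by move=> bf; rewrite /tlift teval_repr. Qed.

Lemma tensor_ind (P : (U ⊗ V)%type -> Prop) :
  (forall u v, P (u ⊗ v)) -> (forall a s t, P s -> P t -> P (a *: s + t)) ->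
  forall t, P t.
Proof.
move=> Pp Pl t; rewrite -[t]treprK.
have P0 : P 0.
  have := Pl (-1) _ _ (Pp 0 0) (Pp 0 0).
  by rewrite scaleN1r addNr.
have tpiD (r s : tterm U V) : tpi (TAdd r s) = tpi r + tpi s.
  by apply/eqP/tpiP => X f bf /=; rewrite !teval_repr.
have tpiZ a (s : tterm U V) : tpi (TScale a s) = a *: tpi s.
  by apply/eqP/tpiP => X f bf /=; rewrite !teval_repr.
elim: (trepr t) => [u v||r Pr s Ps|a s Ps].
- exact: Pp.
- exact: P0.
- by rewrite tpiD -[tpi r]scale1r; apply: Pl.
- by rewrite tpiZ -[_ *: _]addr0; apply: Pl.
Qed.

Lemma tlift_uniq (g h : (U ⊗ V)%type -> W) : linear g -> linear h ->
  (forall u v, g (u ⊗ v) = h (u ⊗ v)) -> g =1 h.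
Proof.
move=> lg lh gh; elim/tensor_ind => // a s t es et.
by rewrite lg lh es et.
Qed.

Lemma eq_tlift f f' t : (forall u v, f u v = f' u v) -> tlift f t = tlift f' t.
Proof.
move=> ff'; rewrite /tlift; elim: (trepr t) => //= [r -> s -> //|a s -> //].
Qed.

Lemma tlift_linl a f f' t :
  tlift (fun u v => a *: f u v + f' u v) t = a *: tlift f t + tlift f' t.
Proof.
rewrite /tlift; elim: (trepr t) => //= [|r -> s ->|b s ->].
- by rewrite scaler0 addr0.
- by rewrite scalerDr addrACA.
- by rewrite scalerDr !scalerA mulrC.
Qed.

End TensorTheory.

Section TensorMaps.
Variable K : fieldType.

Lemma bilinear2_comp (U V U' V' W : lmodType K) (h : U' -> V' -> W)
    (f : U -> U') (g : V -> V') :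
  bilinear2 h -> linear f -> linear g -> bilinear2 (fun u v => h (f u) (g v)).
Proof.
by move=> [hl hr] lf lg; split=> [v|u] a x y /=; rewrite ?lf ?lg;
  [exact: hl | exact: hr].
Qed.

Lemma bilinear2_lin (U V W W' : lmodType K) (h : U -> V -> W) (f : W -> W') :
  bilinear2 h -> linear f -> bilinear2 (fun u v => f (h u v)).
Proof.
by move=> [hl hr] lf; split=> [v|u] a x y /=; rewrite -lf;
  congr (f _); [exact: hl | exact: hr].
Qed.

Definition tmap (U V U' V' : lmodType K) (f : U -> U') (g : V -> V') :
  U ⊗ V -> U' ⊗ V' := tlift (fun u v => f u ⊗ g v).

Definition tflip (U V : lmodType K) : U ⊗ V -> V ⊗ U :=
  tlift (fun u v => v ⊗ u).

Definition tassoc (U V W : lmodType K) : U ⊗ V ⊗ W -> U ⊗ (V ⊗ W) :=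
  tlift (fun t w => tlift (fun u v => u ⊗ (v ⊗ w)) t).

End TensorMaps.

Section TensorAlgebra.
Variables (K : fieldType) (A B : algType K).
Implicit Types s t u : (A ⊗ B)%type.

Definition tmul s t : (A ⊗ B)%type :=
  tlift (fun a b => tlift (fun a' b' => (a * a') ⊗ (b * b')) t) s.

Let tmul_pure_bil (a : A) (b : B) :
  bilinear2 (fun a' b' => (a * a') ⊗ (b * b')).
Proof.
by apply: bilinear2_comp (tpure_bilinear _ _) _ _ => c x y;
  rewrite mulrDr scalerAr.
Qed.

Fact tmul_bilinear : bilinear2 tmul.
Proof.
have bl t : bilinear2
    (fun a b => tlift (fun (a' : A) (b' : B) => (a * a') ⊗ (b * b')) t).
  split=> [b|a] c x y; rewrite -tlift_linl; apply: eq_tlift => a' b' /=.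
    by rewrite mulrDl -scalerAl tpureDl tpureZl.
  by rewrite mulrDl -scalerAl tpureDr tpureZr.
split=> [t|s]; first exact: tlift_linear (bl t).
move=> c t u; rewrite /tmul -tlift_linl; apply: eq_tlift => a b.
exact: tlift_linear.
Qed.

Fact tmulE (a a' : A) (b b' : B) :
  tmul (a ⊗ b) (a' ⊗ b') = (a * a') ⊗ (b * b').
Proof.
rewrite /tmul tlift_pure ?tlift_pure //.
split=> [y|x] c u v; rewrite -tlift_linl; apply: eq_tlift => x' y' /=.
  by rewrite mulrDl -scalerAl tpureDl tpureZl.
by rewrite mulrDl -scalerAl tpureDr tpureZr.
Qed.

Let tmull t : linear (tmul^~ t) := tmul_bilinear.1 t.
Let tmulr s : linear (tmul s) := tmul_bilinear.2 s.

Fact tmulA : associative tmul.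
Proof.
move=> s t u; elim/tensor_ind: s => [a b|c s s' es es'].
  elim/tensor_ind: t => [a' b'|c s s' es es'].
    elim/tensor_ind: u => [a'' b''|c s s' es es'].
      by rewrite !tmulE !mulrA.
    by rewrite !(tmulr _ c) es es'.
  by rewrite (tmull _ c) !(tmulr _ c) (tmull _ c) es es'.
by rewrite !(tmull _ c) es es'.
Qed.

Fact tmul1l : left_id (1 ⊗ 1) tmul.
Proof.
move=> t; elim/tensor_ind: t => [a b|c s s' es es'].
  by rewrite tmulE !mul1r.
by rewrite tmulr es es'.
Qed.

Fact tmul1r : right_id (1 ⊗ 1) tmul.
Proof.
move=> t; elim/tensor_ind: t => [a b|c s s' es es'].
  by rewrite tmulE !mulr1.
by rewrite tmull es es'.
Qed.

Fact tmulDl : left_distributive tmul +%R.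
Proof. by move=> s t u; apply: linear_add (tmull u) _ _. Qed.

Fact tmulDr : right_distributive tmul +%R.
Proof. by move=> s t u; apply: linear_add (tmulr s) _ _. Qed.

Fact tone_neq0 : (1 : A) ⊗ (1 : B) != 0.
Proof.
have [phi lphi phi1] := exists_functional (oner_neq0 A).
pose f (a : A) (b : B) := (phi a : K) *: b.
have bf : bilinear2 f.
  split=> [b|a] c x y; rewrite /f /=; last by rewrite scalerDr !scalerA mulrC.
  by rewrite lphi scalerDl scalerA.
apply/eqP => /(congr1 (tlift f)); rewrite tlift_pure // /f phi1 scale1r.
by rewrite (linear_0 (tlift_linear bf)) => /eqP; rewrite oner_eq0.
Qed.

HB.instance Definition _ := GRing.Zmodule_isNzRing.Build (A ⊗ B)%type
  tmulA tmul1l tmul1r tmulDl tmulDr tone_neq0.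

Fact tscaleAl (c : K) s t : c *: (s * t) = (c *: s) * t.
Proof. by rewrite [RHS](linear_scale (tmull t)). Qed.

HB.instance Definition _ :=
  GRing.Lmodule_isLalgebra.Build K (A ⊗ B)%type tscaleAl.

Fact tscaleAr (c : K) s t : c *: (s * t) = s * (c *: t).
Proof. by rewrite [RHS](linear_scale (tmulr s)). Qed.

HB.instance Definition _ :=
  GRing.Lalgebra_isAlgebra.Build K (A ⊗ B)%type tscaleAr.

Lemma tpureM (a a' : A) (b b' : B) :
  (a ⊗ b) * (a' ⊗ b') = (a * a') ⊗ (b * b').
Proof. exact: tmulE. Qed.

End TensorAlgebra.

HB.mixin Record Vector_isLie (K : fieldType) g of Vector K g := {
  lie : g -> g -> g;
  lie_bilinear : bilinear2 lie;
  liexx : forall x, lie x x = 0;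
  lie_jacobi : forall x y z,
    lie x (lie y z) + lie y (lie z x) + lie z (lie x y) = 0
}.

(* Finite-dimensional Lie algebras over K. *)
#[short(type="lieAlgType")]
HB.structure Definition LieAlgebra (K : fieldType) :=
  { g of Vector K g & Vector_isLie K g }.

Section Semisimple.
Variables (K : fieldType) (g : lieAlgType K).

Definition lie_ideal (I : {vspace g}) : Prop :=
  forall x y : g, y \in I -> lie x y \in I.

(* The span of all brackets of elements of I; brackets of basis vectors *)
(* suffice by bilinearity.                                              *)
Definition lie_derived (I : {vspace g}) : {vspace g} :=
  span [seq lie x y | x <- vbasis I, y <- vbasis I].

Definition lie_solvable (I : {vspace g}) : Prop :=
  exists n, iter n lie_derived I = 0%VS.

Definition semisimple : Prop :=
  forall I : {vspace g}, lie_ideal I -> lie_solvable I -> I = 0%VS.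

End Semisimple.

Section Enveloping.
Variables (K : fieldType) (g : lieAlgType K).

Inductive uterm :=
  | UConst of K
  | UGen of g
  | UAdd of uterm & uterm
  | UMul of uterm & uterm.

HB.instance Definition _ := gen_eqMixin uterm.
HB.instance Definition _ := gen_choiceMixin uterm.

Definition lie_morphism (B : algType K) (rho : g -> B) : Prop :=
  linear rho /\
  forall x y, rho (lie x y) = rho x * rho y - rho y * rho x.

Fixpoint ueval (B : algType K) (rho : g -> B) (t : uterm) : B :=
  match t with
  | UConst c => c%:A
  | UGen x => rho x
  | UAdd s t => ueval rho s + ueval rho t
  | UMul s t => ueval rho s * ueval rho t
  end.

(* Two noncommutative polynomials in the elements of g are identified iff     *)
(* they agree under every Lie morphism from g to an associative algebra; the  *)
(* quotient is the algebra with the universal property of U(g) (uea_lift).    *)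
Definition urel (s t : uterm) : bool :=
  `[< forall (B : algType K) (rho : g -> B), lie_morphism rho ->
        ueval rho s = ueval rho t >].

Lemma urel_refl : reflexive urel. Proof. by move=> t; apply/asboolP. Qed.

Lemma urel_sym : symmetric urel.
Proof. by move=> s t; apply/asboolP/asboolP=> h B rho /h. Qed.

Lemma urel_trans : transitive urel.
Proof.
by move=> t s u /asboolP h /asboolP k; apply/asboolP=> B rho lrho; rewrite h ?k.
Qed.

Canonical urel_equiv := EquivRel urel urel_refl urel_sym urel_trans.

Definition uea := {eq_quot urel_equiv}.

HB.instance Definition _ := Choice.on uea.

Definition upi (t : uterm) : uea := \pi_uea t.
Definition urepr (t : uea) : uterm := repr t.

Lemma ureprK t : upi (urepr t) = t. Proof. exact: reprK. Qed.

Lemma upiP s t : reflect (forall (B : algType K) (rho : g -> B),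
  lie_morphism rho -> ueval rho s = ueval rho t) (upi s == upi t).
Proof. by rewrite eqmodE; apply: asboolP. Qed.

Lemma ueval_repr (B : algType K) (rho : g -> B) t :
  lie_morphism rho -> ueval rho (urepr (upi t)) = ueval rho t.
Proof. by move=> lrho; have /eqP/upiP := ureprK (upi t); apply. Qed.

Let ueqP s t : (forall (B : algType K) (rho : g -> B), lie_morphism rho ->
  ueval rho s = ueval rho t) -> upi s = upi t.
Proof. by move=> h; apply/eqP/upiP. Qed.

Definition uzero := upi (UConst 0).
Definition uone := upi (UConst 1).
Definition uadd s t := upi (UAdd (urepr s) (urepr t)).
Definition umul s t := upi (UMul (urepr s) (urepr t)).
Definition uscale c t := upi (UMul (UConst c) (urepr t)).
Definition uopp := uscale (-1).

Fact uaddA : associative uadd.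
Proof. by move=> s t u; apply: ueqP => B rho l /=; rewrite !ueval_repr //= addrA. Qed.
Fact uaddC : commutative uadd.
Proof. by move=> s t; apply: ueqP => B rho l /=; rewrite addrC. Qed.
Fact uadd0 : left_id uzero uadd.
Proof.
move=> t; rewrite -[RHS]ureprK; apply: ueqP => B rho l /=.
by rewrite ueval_repr //= scale0r add0r.
Qed.
Fact uaddN : left_inverse uzero uopp uadd.
Proof.
move=> t; apply: ueqP => B rho l /=.
by rewrite ueval_repr //= mulr_algl scaleN1r scale0r addNr.
Qed.

HB.instance Definition _ := GRing.isZmodule.Build uea uaddA uaddC uadd0 uaddN.

Fact umulA : associative umul.
Proof. by move=> s t u; apply: ueqP => B rho l /=; rewrite !ueval_repr //= mulrA. Qed.
Fact umul1l : left_id uone umul.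
Proof.
move=> t; rewrite -[RHS]ureprK; apply: ueqP => B rho l /=.
by rewrite ueval_repr //= scale1r mul1r.
Qed.
Fact umul1r : right_id uone umul.
Proof.
move=> t; rewrite -[RHS]ureprK; apply: ueqP => B rho l /=.
by rewrite ueval_repr //= scale1r mulr1.
Qed.
Fact umulDl : left_distributive umul uadd.
Proof.
by move=> s t u; apply: ueqP => B rho l /=; rewrite !ueval_repr //= mulrDl.
Qed.
Fact umulDr : right_distributive umul uadd.
Proof.
by move=> s t u; apply: ueqP => B rho l /=; rewrite !ueval_repr //= mulrDr.
Qed.
Fact uone_neq0 : uone != 0.
Proof.
apply/negP => /upiP /(_ K^o (fun=> 0)) /=.
have l : lie_morphism (fun _ : g => 0 : K^o).
  by split=> [c x y|x y]; rewrite ?scaler0 ?mul0r ?addr0 ?subr0.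
by move=> /(_ l)/eqP; rewrite scale1r scale0r oner_eq0.
Qed.

HB.instance Definition _ := GRing.Zmodule_isNzRing.Build uea
  umulA umul1l umul1r umulDl umulDr uone_neq0.

Fact uscaleA a b t : uscale a (uscale b t) = uscale (a * b) t.
Proof.
by apply: ueqP => B rho l /=; rewrite ueval_repr //= !mulr_algl scalerA.
Qed.
Fact uscale1 : left_id 1 uscale.
Proof.
move=> t; rewrite -[RHS]ureprK; apply: ueqP => B rho l /=.
by rewrite scale1r mul1r.
Qed.
Fact uscaleDr : right_distributive uscale +%R.
Proof.
by move=> a s t; apply: ueqP => B rho l /=; rewrite !ueval_repr //= mulrDr.
Qed.
Fact uscaleDl t : {morph uscale^~ t : a b / a + b}.
Proof.
move=> a b; apply: ueqP => B rho l /=.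
by rewrite !ueval_repr //= !mulr_algl scalerDl.
Qed.

HB.instance Definition _ :=
  GRing.Zmodule_isLmodule.Build K uea uscaleA uscale1 uscaleDr uscaleDl.

Fact uscaleAl (c : K) (s t : uea) : c *: (s * t) = (c *: s) * t.
Proof. by apply: ueqP => B rho l /=; rewrite !ueval_repr //= mulrA. Qed.

HB.instance Definition _ := GRing.Lmodule_isLalgebra.Build K uea uscaleAl.

Fact uscaleAr (c : K) (s t : uea) : c *: (s * t) = s * (c *: t).
Proof.
apply: ueqP => B rho l /=.
by rewrite !ueval_repr //= !mulr_algl scalerAr.
Qed.

HB.instance Definition _ := GRing.Lalgebra_isAlgebra.Build K uea uscaleAr.

Definition uea_inj (x : g) : uea := upi (UGen x).

(* The algebra morphism extending rho; meaningful when rho is a Lie morphism. *)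
Definition uea_lift (B : algType K) (rho : g -> B) (u : uea) : B :=
  ueval rho (urepr u).

Lemma uea_inj_lie : lie_morphism uea_inj.
Proof.
split=> [c x y|x y]; apply: ueqP => B rho l /=.
  by rewrite !ueval_repr //= mulr_algl ueval_repr // l.1.
rewrite !ueval_repr //= !ueval_repr //= l.2 mulr_algl scaleN1r.
by rewrite !ueval_repr.
Qed.

Lemma upiD s t : upi (UAdd s t) = upi s + upi t.
Proof. by apply: ueqP => B rho l /=; rewrite !ueval_repr. Qed.
Lemma upiM s t : upi (UMul s t) = upi s * upi t.
Proof. by apply: ueqP => B rho l /=; rewrite !ueval_repr. Qed.
Lemma upiC c : upi (UConst c) = c%:A.
Proof.
apply: ueqP => B rho l /=.
by rewrite ueval_repr //= scale1r mulr1.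
Qed.

Lemma uea_ind (P : uea -> Prop) :
  (forall c, P c%:A) -> (forall x, P (uea_inj x)) ->
  (forall u v, P u -> P v -> P (u + v)) ->
  (forall u v, P u -> P v -> P (u * v)) -> forall u, P u.
Proof.
move=> PC PG PD PM u; rewrite -[u]ureprK.
elim: (urepr u) => [c|x|s Ps t Pt|s Ps t Pt].
- by rewrite upiC.
- exact: PG.
- by rewrite upiD; apply: PD.
- by rewrite upiM; apply: PM.
Qed.

Section Lift.
Variables (B : algType K) (rho : g -> B).
Hypothesis lrho : lie_morphism rho.

Lemma uea_liftG x : uea_lift rho (uea_inj x) = rho x.
Proof. exact: ueval_repr. Qed.

Lemma uea_lift_linear : linear (uea_lift rho).
Proof.
move=> c u v; rewrite /uea_lift ueval_repr //= -/(urepr (c *: u)).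
by rewrite ueval_repr //= mulr_algl.
Qed.

Lemma uea_liftM : {morph uea_lift rho : u v / u * v}.
Proof. by move=> u v; rewrite /uea_lift ueval_repr. Qed.

Lemma uea_lift1 : uea_lift rho 1 = 1.
Proof. by rewrite /uea_lift ueval_repr //= scale1r. Qed.

Lemma uea_lift_uniq (h : uea -> B) : linear h -> h 1 = 1 ->
  {morph h : u v / u * v} -> (forall x, h (uea_inj x) = rho x) ->
  h =1 uea_lift rho.
Proof.
move=> lh h1 hM hG; elim/uea_ind => [c|x|u v eu ev|u v eu ev].
- by rewrite (linear_scale lh) (linear_scale uea_lift_linear) h1 uea_lift1.
- by rewrite hG uea_liftG.
- by rewrite (linear_add lh) (linear_add uea_lift_linear) eu ev.
- by rewrite hM uea_liftM eu ev.
Qed.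

End Lift.

End Enveloping.

Notation "''U' ( g )" := (uea g) (at level 8, format "''U' ( g )") : type_scope.

Section UeaHopf.
Variables (K : fieldType) (g : lieAlgType K).

Definition uea_comul : 'U(g) -> 'U(g) ⊗ 'U(g) :=
  uea_lift (fun x => uea_inj x ⊗ 1 + 1 ⊗ uea_inj x).

Definition uea_counit : 'U(g) -> K^o := uea_lift (fun _ : g => 0 : K^o).

Fixpoint uterm_antipode (t : uterm g) : uterm g :=
  match t with
  | UConst c => UConst g c
  | UGen x => UGen (- x)
  | UAdd s t => UAdd (uterm_antipode s) (uterm_antipode t)
  | UMul s t => UMul (uterm_antipode t) (uterm_antipode s)
  end.

Definition uea_antipode (u : 'U(g)) : 'U(g) := upi (uterm_antipode (urepr u)).

Lemma uea_comul_lie :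
  lie_morphism (fun x : g => uea_inj x ⊗ 1 + 1 ⊗ uea_inj x : 'U(g) ⊗ 'U(g)).
Proof.
have [li mi] := uea_inj_lie g.
split=> [c x y|x y].
  by rewrite li tpureDl tpureDr tpureZl tpureZr scalerDr addrACA.
rewrite mi !mulrDl !mulrDr !tpureM !mul1r !mulr1.
rewrite tpureDl tpureDr -!scaleN1r tpureZl tpureZr !scaleN1r.
rewrite !opprD !addrA.
set a := (_ * _) ⊗ 1; set b := (_ * _) ⊗ 1; set c := 1 ⊗ _; set d := 1 ⊗ _.
set e := uea_inj x ⊗ _; set f := uea_inj y ⊗ _.
by rewrite [RHS](ACl (1*5*4*8*(2*7)*(3*6)))%AC /= !subrr !addr0.
Qed.

Lemma uea_counit_lie : lie_morphism (fun _ : g => 0 : K^o).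
Proof.
by split=> [c x y|x y]; rewrite ?scaler0 ?mul0r ?addr0 ?subr0.
Qed.

End UeaHopf.

Section ConverseAlgebra.
Variables (K : fieldType) (B : algType K).

HB.instance Definition _ := GRing.Lmodule.copy B^c B.

Fact converse_scaleAl (c : K) (u v : B^c) : c *: (u * v) = ((c *: u : B^c) * v : B^c).
Proof.
change (c *: ((v : B) * (u : B)) = (v : B) * (c *: (u : B))).
exact: scalerAr.
Qed.

HB.instance Definition _ :=
  GRing.Lmodule_isLalgebra.Build K B^c converse_scaleAl.

Fact converse_scaleAr (c : K) (u v : B^c) : c *: (u * v) = (u * (c *: v : B^c) : B^c).
Proof.
change (c *: ((v : B) * (u : B)) = (c *: (v : B)) * (u : B)).
exact: scalerAl.
Qed.

HB.instance Definition _ :=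
  GRing.Lalgebra_isAlgebra.Build K B^c converse_scaleAr.

End ConverseAlgebra.

Section Antipode.
Variables (K : fieldType) (g : lieAlgType K).

Lemma ueval_antipode (B : algType K) (rho : g -> B) t : lie_morphism rho ->
  ueval rho (uterm_antipode t) = ueval (fun x => - rho x : B^c) t.
Proof.
move=> [lrho _]; elim: t => [c|x|s es t et|s es t et] //=.
- by rewrite (linear_opp lrho).
- by rewrite es et.
- by rewrite es et.
Qed.

Lemma lie_morphism_opp (B : algType K) (rho : g -> B) :
  lie_morphism rho -> lie_morphism (fun x => - rho x : B^c).
Proof.
move=> [lrho mrho]; split=> [c x y|x y].
  by rewrite lrho opprD -scalerN.
rewrite mrho opprB; congr (_ - _); first exact: esym (mulrNN _ _).
exact: esym (mulrNN _ _).
Qed.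

Lemma uea_antipode_pi (t : uterm g) : uea_antipode (upi t) = upi (uterm_antipode t).
Proof.
apply/eqP/upiP => B rho l; rewrite !ueval_antipode //.
exact: (ueval_repr t (lie_morphism_opp l)).
Qed.

Lemma uea_antipodeG (x : g) : uea_antipode (uea_inj x) = - uea_inj x.
Proof. by rewrite uea_antipode_pi -(linear_opp (uea_inj_lie g).1). Qed.

Lemma uea_antipodeM (u v : 'U(g)) :
  uea_antipode (u * v) = uea_antipode v * uea_antipode u.
Proof.
by rewrite -[u]ureprK -[v]ureprK -upiM !uea_antipode_pi upiM.
Qed.

Lemma uea_antipode_linear : linear (@uea_antipode K g).
Proof.
move=> c u v; rewrite -[u]ureprK -[v]ureprK -mulr_algl -upiC -upiM -upiD.
by rewrite !uea_antipode_pi /= upiD upiM upiC mulr_algr.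
Qed.

End Antipode.

(* Formal power series in h with coefficients in V. *)
Record fps (V : Type) := Fps { fcoef : nat -> V }.

Notation "{ 'fps' V }" := (fps V%type) (format "{ 'fps'  V }") : type_scope.
Notation "s @_ n" := (fcoef s n) (at level 3, left associativity, n at level 2,
  format "s @_ n").

HB.instance Definition _ (V : Type) := gen_eqMixin {fps V}.
HB.instance Definition _ (V : Type) := gen_choiceMixin {fps V}.

Lemma fpsP (V : Type) (s t : {fps V}) : (forall n, s@_n = t@_n) -> s = t.
Proof. by case: s t => s [t] /= e; congr Fps; apply: funext. Qed.

Section FpsZmod.
Variable V : zmodType.
Implicit Types s t : {fps V}.

Definition fzero : {fps V} := Fps (fun=> 0).
Definition fadd s t := Fps (fun n => s@_n + t@_n).
Definition fopp s := Fps (fun n => - s@_n).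

Fact faddA : associative fadd.
Proof. by move=> s t u; apply: fpsP => n /=; rewrite addrA. Qed.
Fact faddC : commutative fadd.
Proof. by move=> s t; apply: fpsP => n /=; rewrite addrC. Qed.
Fact fadd0 : left_id fzero fadd.
Proof. by move=> s; apply: fpsP => n /=; rewrite add0r. Qed.
Fact faddN : left_inverse fzero fopp fadd.
Proof. by move=> s; apply: fpsP => n /=; rewrite addNr. Qed.

HB.instance Definition _ :=
  GRing.isZmodule.Build {fps V} faddA faddC fadd0 faddN.

Definition fconst (v : V) : {fps V} := Fps (fun n => if n is 0%N then v else 0).

Lemma fcoefD s t n : (s + t)@_n = s@_n + t@_n. Proof. by []. Qed.
Lemma fcoef0 n : (0 : {fps V})@_n = 0. Proof. by []. Qed.
Lemma fcoefN s n : (- s)@_n = - s@_n. Proof. by []. Qed.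

End FpsZmod.

Notation "v %:S" := (fconst v) (at level 1, left associativity, format "v %:S").

(* Cauchy product of coefficients along op. *)
Definition fconv (U V : Type) (W : zmodType) (op : U -> V -> W)
    (s : {fps U}) (t : {fps V}) : {fps W} :=
  Fps (fun n => \sum_(i < n.+1) op s@_i t@_(n - i)).

Lemma sum_triangle (W : zmodType) n (F : nat -> nat -> nat -> W) :
  \sum_(i < n.+1) \sum_(j < i.+1) F j (i - j)%N (n - i)%N =
  \sum_(j < n.+1) \sum_(k < (n - j).+1) F j k (n - j - k)%N.
Proof.
transitivity (\sum_(i < n.+1) \sum_(j < n.+1 | (j <= i)%N) F j (i - j)%N (n - i)%N).
  apply: eq_bigr => i _.
  by rewrite (big_ord_widen_cond n.+1 xpredT (fun j => F j (i - j)%N (n - i)%N)).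
rewrite (exchange_big_dep xpredT) //=; apply: eq_bigr => j _.
rewrite -(big_mkord (fun i => j <= i)%N (fun i => F j (i - j)%N (n - i)%N)).
rewrite -(big_mkord xpredT (fun k => F j k (n - j - k)%N)).
rewrite (big_cat_nat (leq0n j)) /=; last exact: ltnW (ltn_ord j).
rewrite big_nat_cond big1 ?add0r; last first.
  by move=> i /andP[/andP[_ ij]]; rewrite leqNgt ij.
rewrite -{1}[nat_of_ord j]add0n big_addn subSn; last by rewrite -ltnS.
apply: eq_big => [k|k _]; first by rewrite leq_addl.
by rewrite addnK -subnDA addnC.
Qed.

Section ConvolutionTheory.
Variables (U V X Y Z W : zmodType).

Lemma fconvDl (op : U -> V -> W) (t : {fps V}) :
  (forall v, {morph op^~ v : x y / x + y}) ->
  {morph fconv op ^~ t : x y / x + y}.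
Proof.
move=> opD x y; apply: fpsP => n /=; rewrite -big_split /=.
by apply: eq_bigr => i _; rewrite opD.
Qed.

Lemma fconvDr (op : U -> V -> W) (s : {fps U}) :
  (forall u, {morph op u : x y / x + y}) ->
  {morph fconv op s : x y / x + y}.
Proof.
move=> opD x y; apply: fpsP => n /=; rewrite -big_split /=.
by apply: eq_bigr => i _; rewrite opD.
Qed.

Lemma morph_sum0 (f : U -> V) : {morph f : x y / x + y} -> f 0 = 0.
Proof. by move=> fD; apply: (addIr (f 0)); rewrite -fD !add0r. Qed.

Lemma fconvA (op1 : X -> Z -> W) (op2 : U -> V -> X)
    (op3 : U -> Y -> W) (op4 : V -> Z -> Y) s t u :
  (forall z, {morph op1^~ z : x y / x + y}) ->
  (forall x, {morph op3 x : y z / y + z}) ->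
  (forall x y z, op1 (op2 x y) z = op3 x (op4 y z)) ->
  fconv op1 (fconv op2 s t) u = fconv op3 s (fconv op4 t u).
Proof.
move=> op1D op3D opA; apply: fpsP => n /=.
pose F j k l := op3 s@_j (op4 t@_k u@_l).
transitivity (\sum_(i < n.+1) \sum_(j < i.+1) F j (i - j)%N (n - i)%N).
  apply: eq_bigr => i _.
  rewrite (big_morph (op1^~ _) (op1D _) (id1 := 0)); last first.
    by apply: (addIr (op1 0 u@_(n - i))); rewrite -op1D !add0r.
  by apply: eq_bigr => j _; rewrite opA.
rewrite sum_triangle; apply: eq_bigr => j _.
rewrite (big_morph (op3 _) (op3D _) (id1 := 0)) //.
by apply: (addIr (op3 s@_j 0)); rewrite -op3D !add0r.
Qed.

Lemma fconv_constl (op : U -> V -> W) u t n :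
  (forall v, op 0 v = 0) -> (fconv op u%:S t)@_n = op u t@_n.
Proof.
by move=> op0; rewrite /= big_ord_recl /= subn0 big1 ?addr0.
Qed.

Lemma fconv_constr (op : U -> V -> W) s v n :
  (forall u, op u 0 = 0) -> (fconv op s v%:S)@_n = op s@_n v.
Proof.
move=> op0; rewrite /= big_ord_recr /= subnn big1 ?add0r // => i _.
by rewrite -(subnSK (ltn_ord i)) /= op0.
Qed.

End ConvolutionTheory.

Section FpsRing.
Variable A : nzRingType.
Implicit Types s t u : {fps A}.

Definition fmul s t : {fps A} := fconv *%R s t.

Fact fmulA : associative fmul.
Proof.
move=> s t u; apply: esym; apply: fconvA => [z x y|x y z|x y z].
- by rewrite mulrDl.
- by rewrite mulrDr.
- by rewrite mulrA.
Qed.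
Fact fmul1l : left_id 1%:S fmul.
Proof.
by move=> s; apply: fpsP => n; rewrite fconv_constl ?mul1r // => x; rewrite mul0r.
Qed.
Fact fmul1r : right_id 1%:S fmul.
Proof.
by move=> s; apply: fpsP => n; rewrite fconv_constr ?mulr1 // => x; rewrite mulr0.
Qed.
Fact fmulDl : left_distributive fmul +%R.
Proof. by move=> s t u; apply: fconvDl => x y z; rewrite mulrDl. Qed.
Fact fmulDr : right_distributive fmul +%R.
Proof. by move=> s t u; apply: fconvDr => x y z; rewrite mulrDr. Qed.
Fact fone_neq0 : (1 : A)%:S != 0.
Proof. by apply/eqP => /(congr1 (fun s => s@_0))/eqP; rewrite oner_eq0. Qed.

HB.instance Definition _ := GRing.Zmodule_isNzRing.Build {fps A}
  fmulA fmul1l fmul1r fmulDl fmulDr fone_neq0.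

Lemma fcoefM s t n : (s * t)@_n = \sum_(i < n.+1) s@_i * t@_(n - i).
Proof. by []. Qed.

End FpsRing.

Section FpsLmod.
Variables (K : nzRingType) (V : lmodType K).

Definition fscale (c : {fps K}) (s : {fps V}) : {fps V} := fconv *:%R c s.

Fact fscaleA a b s : fscale a (fscale b s) = fscale (a * b) s.
Proof.
apply: esym; apply: fconvA => [z x y|x y z|x y z].
- by rewrite scalerDl.
- by rewrite scalerDr.
- by rewrite scalerA.
Qed.
Fact fscale1 : left_id 1 fscale.
Proof.
move=> s; apply: fpsP => n; rewrite fconv_constl ?scale1r // => x.
by rewrite scale0r.
Qed.
Fact fscaleDr : right_distributive fscale +%R.
Proof. by move=> s t u; apply: fconvDr => x y z; rewrite scalerDr. Qed.
Fact fscaleDl s : {morph fscale^~ s : a b / a + b}.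
Proof. by apply: fconvDl => x y z; rewrite scalerDl. Qed.

HB.instance Definition _ :=
  GRing.Zmodule_isLmodule.Build {fps K} {fps V}
    fscaleA fscale1 fscaleDr fscaleDl.

Lemma fcoefZ (c : {fps K}) (s : {fps V}) n :
  (c *: s)@_n = \sum_(i < n.+1) c@_i *: s@_(n - i).
Proof. by []. Qed.

End FpsLmod.

Section FpsAlgebra.
Variables (K : fieldType) (A : algType K).

Fact fscaleAl (c : {fps K}) (s t : {fps A}) : c *: (s * t) = (c *: s) * t.
Proof.
apply: esym; apply: fconvA => [z x y|x y z|x y z].
- by rewrite mulrDl.
- by rewrite scalerDr.
- by rewrite scalerAl.
Qed.

HB.instance Definition _ :=
  GRing.Lmodule_isLalgebra.Build {fps K} {fps A} fscaleAl.

End FpsAlgebra.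

Section FpsMaps.
Variable K : fieldType.

Definition fmap (V W : Type) (f : V -> W) (s : {fps V}) : {fps W} :=
  Fps (fun n => f s@_n).

(* The C[[h]]-linear (h-adically continuous) extension of                     *)
(* u ⊗ v |-> F u v to (U ⊗ V)[[h]], the completed tensor product of U[[h]]    *)
(* and V[[h]]; meaningful when F is bilinear.                                 *)
Definition hlift (U V W : lmodType K) (F : U -> V -> {fps W})
    (s : {fps U ⊗ V}) : {fps W} :=
  Fps (fun n => \sum_(i < n.+1) tlift (fun u v => (F u v)@_(n - i)) s@_i).

End FpsMaps.

Section FpsAlgebraRight.
Variables (K : fieldType) (A : algType K).

Fact fconvC (U V : Type) (W : zmodType) (op : U -> V -> W) s t :
  fconv op s t = fconv (fun v u => op u v) t s.
Proof.
apply: fpsP => n /=; rewrite (reindex_inj rev_ord_inj) /=.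
by apply: eq_bigr => i _; rewrite subSS subKn // -ltnS.
Qed.

Fact fscaleAr (c : {fps K}) (s t : {fps A}) : c *: (s * t) = s * (c *: t).
Proof.
rewrite fscaleAl.
have -> : c *: s = fconv (fun (a : A) (k : K) => k *: a) s c.
  by rewrite -[LHS]/(fconv _ c s) fconvC.
apply: fconvA => [z x y|x y z|x y z].
- by rewrite mulrDl.
- by rewrite mulrDr.
- by rewrite -scalerAl scalerAr.
Qed.

HB.instance Definition _ :=
  GRing.Lalgebra_isAlgebra.Build {fps K} {fps A} fscaleAr.

End FpsAlgebraRight.

Section ClassicalRMatrix.
Variables (K : fieldType) (g : lieAlgType K).
Implicit Types (x y z w : g) (r s : (g ⊗ g)%type).

(* Exterior powers of g are realized as antisymmetric tensors. *)
Definition wedge2 x y : g ⊗ g := x ⊗ y - y ⊗ x.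

Definition wedge3 x y z : g ⊗ g ⊗ g :=
  x ⊗ y ⊗ z + y ⊗ z ⊗ x + z ⊗ x ⊗ y
  - y ⊗ x ⊗ z - x ⊗ z ⊗ y - z ⊗ y ⊗ x.

(* Schouten bracket of antisymmetric tensors: by schouten_wedge below it is   *)
(* the usual one up to the overall sign, and the sign is the one for which    *)
(* the Schouten bracket of { , }_r with itself is phi_A for phi = [[r, r]].   *)
Definition schouten r s : g ⊗ g ⊗ g :=
  - tlift (fun x y => tlift (fun z w => wedge3 (lie x z) y w) s) r.

Definition ad2 x : g ⊗ g -> g ⊗ g :=
  tlift (fun y z => lie x y ⊗ z + y ⊗ lie x z).

Definition ad3 x : g ⊗ g ⊗ g -> g ⊗ g ⊗ g :=
  tlift (fun t z => ad2 x t ⊗ z + t ⊗ lie x z).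

Definition classical_rmatrix r : Prop :=
  tflip r = - r /\ forall x, ad3 x (schouten r r) = 0.

Definition rmatrix_uea r : 'U(g) ⊗ 'U(g) := tmap (@uea_inj K g) (@uea_inj K g) r.

Definition cobracket r x : 'U(g) ⊗ 'U(g) :=
  rmatrix_uea r * uea_comul (uea_inj x) - uea_comul (uea_inj x) * rmatrix_uea r.

End ClassicalRMatrix.

Section QuantumGroup.
Variables (K : fieldType) (g : lieAlgType K).
Local Notation U := 'U(g).

(* A quantization of (g, r): a topological Hopf algebra structure on the      *)
(* algebra U(g)[[h]]. As U(g)[[h]] (x) U(g)[[h]], completed, is               *)
(* (U(g) ⊗ U(g))[[h]], maps on tensor products are given by hlift.            *)
Record quantum_group (r : g ⊗ g) := QuantumGroup {
  hcomul : {lrmorphism {fps U} -> {fps U ⊗ U}};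
  hcounit : {lrmorphism {fps U} -> {fps K} | *%R};
  hantipode : {linear {fps U} -> {fps U}};
  hcomulA : forall x : {fps U},
    fmap (@tassoc K U U U)
      (hlift (fun u v => fmap (fun t => t ⊗ v) (hcomul u%:S)) (hcomul x))
    = hlift (fun u v => fmap (fun t => u ⊗ t) (hcomul v%:S)) (hcomul x);
  hcounitl : forall x : {fps U},
    hlift (fun u v => hcounit u%:S *: v%:S) (hcomul x) = x;
  hcounitr : forall x : {fps U},
    hlift (fun u v => hcounit v%:S *: u%:S) (hcomul x) = x;
  hantipodel : forall x : {fps U},
    hlift (fun u v => hantipode u%:S * v%:S) (hcomul x) = (hcounit x)%:A;
  hantipoder : forall x : {fps U},
    hlift (fun u v => u%:S * hantipode v%:S) (hcomul x) = (hcounit x)%:A;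
  hcomul_mod : forall x : {fps U}, (hcomul x)@_0 = uea_comul x@_0;
  hcounit_mod : forall x : {fps U}, (hcounit x)@_0 = uea_counit x@_0;
  hantipode_mod : forall x : {fps U}, (hantipode x)@_0 = uea_antipode x@_0;
  hcomul_cobracket : forall x : g,
    (hcomul (uea_inj x)%:S)@_1 - tflip (hcomul (uea_inj x)%:S)@_1
    = cobracket r x;
  hcomul_twist : exists F F' : {fps U ⊗ U},
    [/\ F * F' = 1, F' * F = 1, F@_0 = 1, F@_1 = 2^-1 *: rmatrix_uea r
      & forall x : U, hcomul x%:S = F * (uea_comul x)%:S * F']
}.

End QuantumGroup.

Section InvariantAlgebra.
Variables (K : fieldType) (g : lieAlgType K) (A : lmodType K).
Local Notation U := 'U(g).

Definition tact (act : U -> A -> A) (T : U ⊗ U) (t : A ⊗ A) : A ⊗ A :=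
  tlift (fun u v => tmap (act u) (act v) t) T.

(* Commutative associative algebra structures on A, not necessarily unital,   *)
(* with a compatible U(g)-module structure.                                   *)
Record inv_algebra := InvAlgebra {
  act : U -> A -> A;
  amul : A -> A -> A;
  act_bilinear : bilinear2 act;
  act1 : forall a, act 1 a = a;
  actM : forall x y a, act (x * y) a = act x (act y a);
  amul_bilinear : bilinear2 amul;
  amulA : associative amul;
  amulC : commutative amul;
  amul_inv : forall x a b,
    act x (amul a b) = tlift amul (tact act (uea_comul x) (a ⊗ b))
}.

Variable S : inv_algebra.

Definition hact : {fps U} -> {fps A} -> {fps A} := fconv (act S).

Definition htact : {fps U ⊗ U} -> {fps A ⊗ A} -> {fps A ⊗ A} :=
  fconv (tact (act S)).

Record quantization := Quantization {
  hmul : {fps A} -> {fps A} -> {fps A};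
  hmul_bilinear : bilinear_for *:%R *:%R hmul;
  hmulA : associative hmul;
  hmul_mod : forall a b : {fps A}, (hmul a b)@_0 = amul S a@_0 b@_0
}.

Definition quantum_invariant (r : g ⊗ g) (Uh : quantum_group r)
    (Ah : quantization) : Prop :=
  forall (x : U) (a b : A),
    hact x%:S (hmul Ah a%:S b%:S) =
    hlift (fun a b => hmul Ah a%:S b%:S)
      (htact (hcomul Uh x%:S) (a ⊗ b)%:S).

Definition mu1 (Ah : quantization) (a b : A) : A := (hmul Ah a%:S b%:S)@_1.

Definition poisson (Ah : quantization) (a b : A) : A :=
  mu1 Ah a b - mu1 Ah b a.

Definition is_bracket (f : A -> A -> A) : Prop :=
  [/\ bilinear2 f,
      forall a b, f b a = - f a b,
      forall a b c, f (amul S a b) c = amul S a (f b c) + amul S (f a c) b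
    & forall a b c, f a (amul S b c) = amul S (f a b) c + amul S b (f a c)].

Definition inv_bracket (f : A -> A -> A) : Prop :=
  forall (x : U) (a b : A),
    act S x (f a b) = tlift f (tact (act S) (uea_comul x) (a ⊗ b)).

Definition rbracket (r : g ⊗ g) (a b : A) : A :=
  tlift (amul S) (tact (act S) (rmatrix_uea r) (a ⊗ b)).

Definition bschouten (f f' : A -> A -> A) (a b c : A) : A :=
  f (f' a b) c + f' (f a b) c
  + (f (f' b c) a + f' (f b c) a)
  + (f (f' c a) b + f' (f c a) b).

Definition compatible (f f' : A -> A -> A) : Prop :=
  forall a b c, bschouten f f' a b c = 0.

Definition trivector_op (phi : g ⊗ g ⊗ g) (a b c : A) : A :=
  tlift (fun t z => tlift (fun x y =>
    amul S (amul S (act S (uea_inj x) a) (act S (uea_inj y) b))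
           (act S (uea_inj z) c)) t) phi.

End InvariantAlgebra.

Section SchoutenTheory.
Variables (K : fieldType) (g : lieAlgType K).
Implicit Types (x y z w : g).

Let linD (U V : lmodType K) (f f' : U -> V) :
  linear f -> linear f' -> linear (fun u => f u + f' u).
Proof. by move=> lf lf' a u v; rewrite lf lf' scalerDr addrACA. Qed.

Let linN (U V : lmodType K) (f : U -> V) :
  linear f -> linear (fun u => - f u).
Proof. by move=> lf a u v; rewrite lf opprD scalerN. Qed.

Let lin_pure1 (U V W : lmodType K) (v : V) (w : W) :
  linear (fun u : U => u ⊗ v ⊗ w).
Proof. by move=> a u u'; rewrite !tpureDl !tpureZl. Qed.
Let lin_pure2 (U V W : lmodType K) (u : U) (w : W) :
  linear (fun v : V => u ⊗ v ⊗ w).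
Proof. by move=> a v v'; rewrite tpureDr tpureDl tpureZr tpureZl. Qed.
Let lin_pure3 (U V W : lmodType K) (u : U) (v : V) :
  linear (fun w : W => u ⊗ v ⊗ w).
Proof. by move=> a w w'; rewrite tpureDr tpureZr. Qed.
Ltac wedge3_lin := by do ![apply: linD | apply: linN | apply: lin_pure1
  | apply: lin_pure2 | apply: lin_pure3].

Lemma wedge3_linear1 y z : linear (fun x => wedge3 x y z).
Proof. wedge3_lin. Qed.
Lemma wedge3_linear2 x z : linear (fun y => wedge3 x y z).
Proof. wedge3_lin. Qed.
Lemma wedge3_linear3 x y : linear (fun z => wedge3 x y z).
Proof. wedge3_lin. Qed.

Lemma schouten_wedge x y z w :
  schouten (wedge2 x y) (wedge2 z w) =
  - (wedge3 (lie x z) y w - wedge3 (lie x w) y z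
     - wedge3 (lie y z) x w + wedge3 (lie y w) x z).
Proof.
have [lie_l lie_r] := @lie_bilinear K g.
have bi x' y' : bilinear2 (fun z w => wedge3 (lie x' z) y' w).
  split=> [v|u]; last exact: wedge3_linear3.
  exact: linear_comp (lie_r x') (wedge3_linear1 _ _).
have bo s : bilinear2
    (fun x y => tlift (fun z w => wedge3 (lie x z) y w) s).
  split=> [y'|x'] a u v; rewrite -tlift_linl; apply: eq_tlift => z' w' /=.
    by rewrite [lie _ _]lie_l wedge3_linear1.
  by rewrite wedge3_linear2.
rewrite /schouten /wedge2; congr (- _).
have lo s := tlift_linear (bo s); have li x' y' := tlift_linear (bi x' y').
rewrite (linear_add (lo _)) (linear_opp (lo _)) !tlift_pure //.
rewrite !(linear_add (li _ _)) !(linear_opp (li _ _)) !tlift_pure //.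
move: (wedge3 _ y w) (wedge3 _ y z) (wedge3 _ x w) (wedge3 _ x z) => a b c d.
by rewrite opprB addrA [RHS]addrAC.
Qed.

End SchoutenTheory.

(* Main.v *)
Require Import Defs.
From mathcomp Require Import all_boot all_order all_algebra.
From mathcomp Require Import complex reals.

(* As Delta_1 - sigma Delta_1 = delta, the order h part of the invariance of
   mu_h, antisymmetrized, says that {,} fails to be U(g)-invariant exactly by
   mu [r, Delta x], which is minus the failure for {,}_r; hence
   f := {,} + {,}_r is invariant. By the Leibniz rule alone, an invariant bracket
   is compatible with {,}_r. The h-commutator is divisible by h, so its Leibniz
   and Jacobi identities give those of {,}, and
     0 = [[{,}, {,}]] = [[f, f]] - 2 [[f, {,}_r]] + [[{,}_r, {,}_r]]
   yields the last claim. *)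

Set Implicit Arguments.
Unset Strict Implicit.
Unset Printing Implicit Defensive.

Import GRing.Theory.
Local Open Scope ring_scope.

(** * Linear maps out of tensor products *)

Section TensorLift.
Variable K : fieldType.

Lemma tlift_comp (U V W X : lmodType K) (h : W -> X) (f : U -> V -> W) t :
  linear h -> h (tlift f t) = tlift (fun u v => h (f u v)) t.
Proof.
move=> lh; rewrite /tlift; elim: (trepr t) => //= [|s IHs u IHu|c s IHs].
- exact: linear_0.
- by rewrite (linear_add lh) IHs IHu.
- by rewrite (linear_scale lh) IHs.
Qed.

Lemma tliftD (U V W : lmodType K) (f f' : U -> V -> W) t :
  tlift (fun u v => f u v + f' u v) t = tlift f t + tlift f' t.
Proof.
rewrite -[tlift f t]scale1r -tlift_linl.
by apply: eq_tlift => u v; rewrite scale1r.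
Qed.

Lemma tliftN (U V W : lmodType K) (f : U -> V -> W) t :
  tlift (fun u v => - f u v) t = - tlift f t.
Proof.
have lN : linear (fun w : W => - w) by move=> c u v; rewrite opprD scalerN.
by rewrite (tlift_comp _ _ lN).
Qed.

(** Both sides evaluate finite formal combinations representing [s] and [t]; the two finite sums are
    interchanged by induction on the one for [s]. *)
Lemma tlift_exchange (U V U' V' W : lmodType K) (F : U -> V -> U' -> V' -> W)
    (s : (U ⊗ V)%type) (t : (U' ⊗ V')%type) :
  tlift (fun x y => tlift (fun z w => F x y z w) t) s =
  tlift (fun z w => tlift (fun x y => F x y z w) s) t.
Proof.
rewrite {1}/tlift -/(tlift _ t).
transitivity (tlift (fun z w => teval (fun x y => F x y z w) (trepr s)) t)
  => //.
elim: (trepr s) => //= [|s1 IH1 s2 IH2|c s1 IH1].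
- rewrite /tlift; elim: (trepr t) => //= [t1 <- t2 <-|c t1 <-].
    by rewrite addr0.
  by rewrite scaler0.
- by rewrite IH1 IH2 -tliftD.
- rewrite IH1 (tlift_comp _ _ (_ : linear (fun w : W => c *: w))) //.
  by move=> a u v; rewrite scalerDr !scalerA mulrC.
Qed.

Lemma tlift_flip (U V W : lmodType K) (f : V -> U -> W) (t : (U ⊗ V)%type) :
  bilinear2 f -> tlift f (tflip t) = tlift (fun u v => f v u) t.
Proof.
move=> bf; rewrite /tflip (tlift_comp _ _ (tlift_linear bf)).
by apply: eq_tlift => u v; rewrite tlift_pure.
Qed.

Lemma tlift_map (U V U' V' W : lmodType K) (f : U' -> V' -> W)
    (p : U -> U') (q : V -> V') t :
  bilinear2 f -> tlift f (tmap p q t) = tlift (fun u v => f (p u) (q v)) t.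
Proof.
move=> bf; rewrite /tmap (tlift_comp _ _ (tlift_linear bf)).
by apply: eq_tlift => u v; rewrite tlift_pure.
Qed.

(** The antisymmetry of [r] enters the computations below in this form: swapping its two legs costs
    a sign. *)
Lemma tlift_skew (U W : lmodType K) (f : U -> U -> W) (t : (U ⊗ U)%type) :
  tflip t = - t -> bilinear2 f ->
  tlift (fun x y => f y x) t = - tlift f t.
Proof.
by move=> st bf; rewrite -tlift_flip // st (linear_opp (tlift_linear bf)).
Qed.

End TensorLift.

(** * Actions and brackets on an invariant commutative algebra *)

Section InvAlgebra.
Variables (K : fieldType) (g : lieAlgType K) (A : lmodType K).
Variable S : inv_algebra g A.

Local Notation "a ** b" := (amul S a b) (at level 40, left associativity).
Local Notation D x := (act S (uea_inj x)).

Lemma amulDl a b c : (a + b) ** c = a ** c + b ** c.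
Proof. exact: (linear_add ((amul_bilinear S).1 c)). Qed.
Lemma amulDr a b c : a ** (b + c) = a ** b + a ** c.
Proof. exact: (linear_add ((amul_bilinear S).2 a)). Qed.
Lemma amulNl a b : (- a) ** b = - (a ** b).
Proof. exact: (linear_opp ((amul_bilinear S).1 b)). Qed.
Lemma amulNr a b : a ** (- b) = - (a ** b).
Proof. exact: (linear_opp ((amul_bilinear S).2 a)). Qed.

Lemma act_linear u : linear (act S u).
Proof. exact: (act_bilinear S).2. Qed.

Lemma act_gen_linear a : linear (fun x : g => D x a).
Proof. exact: linear_comp (uea_inj_lie g).1 ((act_bilinear S).1 a). Qed.

Lemma act_lie x y a : D (lie x y) a = D x (D y a) - D y (D x a).
Proof.
rewrite (uea_inj_lie g).2 -!actM.
have la := (act_bilinear S).1 a.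
by rewrite (linear_add la) (linear_opp la).
Qed.

Lemma tmap_act_bilinear t : bilinear2 (fun u v => tmap (act S u) (act S v) t).
Proof.
have [ll _] := act_bilinear S.
by split=> [v|u] c x y /=; rewrite /tmap -tlift_linl; apply: eq_tlift => a b /=;
  rewrite ll ?tpureDl ?tpureDr ?tpureZl ?tpureZr.
Qed.

Lemma tact_linear T : linear (tact (act S) T).
Proof.
move=> c s t; rewrite /tact -tlift_linl; apply: eq_tlift => u v.
apply: tlift_linear; apply: bilinear2_comp (tpure_bilinear _ _) _ _;
  exact: act_linear.
Qed.

Lemma tact_linearl t : linear (fun T => tact (act S) T t).
Proof. exact: tlift_linear (tmap_act_bilinear t). Qed.

Lemma tactDl T T' t :
  tact (act S) (T + T') t = tact (act S) T t + tact (act S) T' t.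
Proof. exact: (linear_add (tact_linearl t)). Qed.

Lemma tact_pure u v a b :
  tact (act S) (u ⊗ v) (a ⊗ b) = act S u a ⊗ act S v b.
Proof.
rewrite /tact tlift_pure; last exact: tmap_act_bilinear.
rewrite /tmap tlift_pure //.
by apply: bilinear2_comp (tpure_bilinear _ _) _ _; exact: act_linear.
Qed.

Lemma tactM T T' t :
  tact (act S) (T * T') t = tact (act S) T (tact (act S) T' t).
Proof.
elim/tensor_ind: T => [u v|c s s' es es']; last first.
  by rewrite mulrDl -scalerAl (tact_linearl t) es es' -tact_linearl.
elim/tensor_ind: T' => [u' v'|c s s' es es']; last first.
  rewrite mulrDr -scalerAr (tact_linearl t) es es' (tact_linearl t).
  by rewrite (tact_linear (u ⊗ v)).
elim/tensor_ind: t => [a b|c s s' es es'].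
  by rewrite tpureM !tact_pure !actM.
by rewrite (tact_linear _) es es' -!tact_linear.
Qed.

Lemma comul_gen (x : g) :
  uea_comul (uea_inj x) = uea_inj x ⊗ 1 + 1 ⊗ uea_inj x.
Proof. exact: uea_liftG (uea_comul_lie g) x. Qed.

Lemma tact_gen x a b : tact (act S) (uea_comul (uea_inj x)) (a ⊗ b) =
  D x a ⊗ b + a ⊗ D x b.
Proof. by rewrite comul_gen tactDl !tact_pure !act1. Qed.

Lemma act_gen_mul x a b : D x (a ** b) = D x a ** b + a ** D x b.
Proof.
have bm := amul_bilinear S.
by rewrite amul_inv tact_gen (linear_add (tlift_linear bm)) !tlift_pure.
Qed.

(** Skew-symmetry carries linearity and the Leibniz rule over to the second argument. *)
Lemma is_bracket_skew f : (forall c, linear (f^~ c)) ->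
    (forall a b, f b a = - f a b) ->
    (forall a b c, f (a ** b) c = a ** f b c + f a c ** b) ->
  is_bracket S f.
Proof.
move=> lf sf df; split=> //.
- split=> // a c u v; rewrite sf lf opprD -scalerN.
  by rewrite -(sf u) -(sf v).
- move=> a b c; rewrite sf df opprD -amulNr -amulNl -!(sf _ a).
  by rewrite addrC.
Qed.

Lemma is_bracketD f f' : is_bracket S f -> is_bracket S f' ->
  is_bracket S (fun a b => f a b + f' a b).
Proof.
move=> [[lf rf] sf df ef] [[lf' rf'] sf' df' ef'].
apply: is_bracket_skew => [c k a b|a b|a b c].
- by rewrite /= lf lf' scalerDr addrACA.
- by rewrite sf sf' opprD.
- by rewrite df df' amulDr amulDl [_ ** b]amulC addrACA [f' a c ** b]amulC.
Qed.

(* A map commuting with g commutes with U(g): the comultiplication is *)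
(* multiplicative, so invariance passes from u and v to u v.          *)
Lemma inv_bracket_gen f : bilinear2 f ->
    (forall x a b, D x (f a b) = f (D x a) b + f a (D x b)) ->
  inv_bracket S f.
Proof.
move=> bf invf.
have lf := tlift_linear bf.
have l1 := act_bilinear S.
have lc := uea_lift_linear (uea_comul_lie g).
(* In the product case the right factor turns a pure tensor into a sum, so the induction needs the
   claim for every tensor [t]. *)
suff inv u t : act S u (tlift f t) = tlift f (tact (act S) (uea_comul u) t).
  by move=> u a b; rewrite -inv tlift_pure.
elim/uea_ind: u t => [c|x|u v eu ev|u v eu ev] t.
- rewrite (linear_scale (l1.1 _)) act1 /uea_comul (linear_scale lc).
  rewrite (uea_lift1 (uea_comul_lie g)).
  rewrite (linear_scale (tact_linearl t)).
  rewrite (linear_scale lf); congr (c *: tlift f _).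
  elim/tensor_ind: t => [a b|d s s' es es'].
    by rewrite [RHS]tact_pure !act1.
  by rewrite tact_linear -es -es'.
- elim/tensor_ind: t => [a b|c s s' es es'].
    by rewrite tact_gen (linear_add lf) !tlift_pure.
  by rewrite lf act_linear es es' tact_linear lf.
- rewrite (linear_add (l1.1 _)) eu ev /uea_comul (linear_add lc).
  by rewrite tactDl (linear_add lf).
- rewrite actM ev eu /uea_comul (uea_liftM (uea_comul_lie g)).
  by rewrite tactM.
Qed.


Lemma act_pair_bilinear a b :
  bilinear2 (fun u v : 'U(g) => act S u a ** act S v b).
Proof.
by apply: bilinear2_comp (amul_bilinear S) _ _; exact: (act_bilinear S).1.
Qed.

Lemma act_gen_pair_bilinear a b : bilinear2 (fun x y : g => D x a ** D y b).
Proof.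
by apply: bilinear2_comp (amul_bilinear S) _ _; exact: act_gen_linear.
Qed.

(** The operator μT on a ⊗ b. For [T] the image of [r] it is the r-matrix bracket; for [T] the order
    h part of the coproduct it is the defect of invariance of [mu1]. *)
Definition biaction (T : ('U(g) ⊗ 'U(g))%type) (a b : A) : A :=
  tlift (fun u v => act S u a ** act S v b) T.

Lemma biaction_linear a b : linear (fun T => biaction T a b).
Proof. exact: tlift_linear (act_pair_bilinear a b). Qed.

Lemma amul_tact T a b :
  tlift (amul S) (tact (act S) T (a ⊗ b)) = biaction T a b.
Proof.
rewrite /tact (tlift_comp _ _ (tlift_linear (amul_bilinear S))).
apply: eq_tlift => u v.
rewrite tlift_map ?tlift_pure //; last exact: amul_bilinear.
by apply: bilinear2_comp (amul_bilinear S) _ _; exact: act_linear.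
Qed.

(** By commutativity of μ, exchanging the arguments flips [T]. Antisymmetrizing in a and b thus
    replaces Δ_1 by Δ_1 - σΔ_1. *)
Lemma biaction_flip T a b : biaction (tflip T) a b = biaction T b a.
Proof.
rewrite /biaction tlift_flip; last exact: act_pair_bilinear.
by apply: eq_tlift => u v; rewrite amulC.
Qed.

(** * The r-matrix bracket: compatibility with invariant brackets, and its Schouten square *)

Section RMatrix.
Variables (r : (g ⊗ g)%type) (r_skew : tflip r = - r).
Local Notation rb := (rbracket S r).

Lemma rbracketE a b : rb a b = tlift (fun x y => D x a ** D y b) r.
Proof.
rewrite /rbracket amul_tact /biaction /rmatrix_uea tlift_map //.
exact: act_pair_bilinear.
Qed.

Lemma rbracket_skew a b : rb b a = - rb a b.
Proof.
rewrite !rbracketE -tlift_skew //; last exact: act_gen_pair_bilinear.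
by apply: eq_tlift => x y; rewrite amulC.
Qed.

Lemma rbracket_is_bracket : is_bracket S rb.
Proof.
apply: is_bracket_skew => [c k a b|a b|a b c].
- rewrite /= !rbracketE -tlift_linl; apply: eq_tlift => x y.
  by rewrite act_linear (amul_bilinear S).1.
- exact: rbracket_skew.
- rewrite !rbracketE !(tlift_comp _ _ ((amul_bilinear S).2 a)).
  rewrite (tlift_comp _ _ ((amul_bilinear S).1 b)) -tliftD.
  apply: eq_tlift => x y; rewrite act_gen_mul amulDl addrC; congr (_ + _).
    by rewrite amulA.
  by rewrite -!amulA; congr (_ ** _); rewrite amulC.
Qed.

(** In [r, Δ(x)], the product rΔ(x) lets [x] act on the arguments before [r], while Δ(x)r lets it
    act on the value of the bracket, since [D x] is a derivation. *)
Lemma biaction_cobracket x a b :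
  biaction (cobracket r x) a b = rb (D x a) b + rb a (D x b) - D x (rb a b).
Proof.
have lb := biaction_linear a b.
rewrite /cobracket (linear_add lb) (linear_opp lb) comul_gen.
rewrite mulrDr mulrDl !(linear_add lb) /rmatrix_uea /tmap.
have mulr_lin (s : ('U(g) ⊗ 'U(g))%type) : linear (fun t => t * s).
  by move=> c u v; rewrite mulrDl scalerAl.
have mull_lin (s : ('U(g) ⊗ 'U(g))%type) : linear (fun t => s * t).
  by move=> c u v; rewrite mulrDr scalerAr.
rewrite !(tlift_comp _ _ (mulr_lin _)) !(tlift_comp _ _ (mull_lin _)).
rewrite !(tlift_comp _ _ lb) !rbracketE (tlift_comp _ _ (act_linear _)).
rewrite -!tliftD.
have bp := act_pair_bilinear a b.
congr (_ - _); apply: eq_tlift => y z.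
  by rewrite !tpureM !mulr1 /biaction !tlift_pure ?actM.
by rewrite !tpureM !mul1r /biaction !tlift_pure ?actM ?act_gen_mul.
Qed.

(** Each term of the Schouten bracket is a difference of two values of [T]: the Leibniz rule expands
    f({a,b}_r, c), and invariance expands {f(a,b), c}_r. Over the cyclic permutations the first kind
    adds up to the alternating sum of [T], the second to its negative. *)
Lemma rbracket_compatible f : is_bracket S f ->
  (forall x a b, D x (f a b) = f (D x a) b + f a (D x b)) ->
  compatible f rb.
Proof.
move=> [[lf rf] sf df _] invf a b c.
pose T a b c := tlift (fun x y => D x a ** f (D y b) c) r.
have bT a' b' c' : bilinear2 (fun x y => D x a' ** f (D y b') c').
  apply: bilinear2_comp (amul_bilinear S) (act_gen_linear a') _.
  exact: linear_comp (act_gen_linear b') (lf c').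
have frb a' b' c' : f (rb a' b') c' = T a' b' c' - T b' a' c'.
  rewrite rbracketE (tlift_comp _ _ (lf c')) -(tlift_skew r_skew (bT b' a' c')).
  rewrite -tliftD; apply: eq_tlift => x y.
  by rewrite df [f _ _ ** _]amulC.
have rbf a' b' c' : rb (f a' b') c' = T c' b' a' - T c' a' b'.
  rewrite rbracketE -(tlift_skew r_skew (bT c' a' b')) addrC.
  rewrite -[X in _ + X]opprK -(tlift_skew r_skew (bT c' b' a')) -tliftN -tliftD.
  apply: eq_tlift => x y.
  by rewrite invf amulDl (sf _ a') amulNl !(amulC _ (D y c')).
rewrite /bschouten !frb !rbf.
rewrite !addrA.
rewrite [LHS](ACl (1*8*(11*2)*(3*6)*(9*4)*(5*12)*(7*10)))%AC /=.
by rewrite !subrr !addr0.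
Qed.

Lemma act_gen_pair_mul_bilinear a b c :
  bilinear2 (fun x y : g => D x a ** D y b ** c).
Proof.
exact: (bilinear2_lin (act_gen_pair_bilinear a b) ((amul_bilinear S).1 c)).
Qed.

Lemma trivector_op_bilinear a b c :
  bilinear2 (fun t z => tlift (fun x y => D x a ** D y b ** D z c) t).
Proof.
split=> [z|t] k u v; last first.
  rewrite -tlift_linl; apply: eq_tlift => x y.
  by rewrite act_gen_linear (amul_bilinear S).2.
exact: tlift_linear (act_gen_pair_mul_bilinear a b (D z c)) _ _ _.
Qed.

Lemma trivector_op_linear a b c : linear (fun phi => trivector_op S phi a b c).
Proof. exact: tlift_linear (trivector_op_bilinear a b c). Qed.

Lemma trivector_op_pure x y z a b c :
  trivector_op S (x ⊗ y ⊗ z) a b c = D x a ** D y b ** D z c.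
Proof.
rewrite /trivector_op tlift_pure; last exact: trivector_op_bilinear.
by rewrite tlift_pure //; exact: act_gen_pair_mul_bilinear.
Qed.

(** By the derivation rule only terms [Q] remain on the left, where both copies of [r] act on one
    argument. On the right the Lie brackets become commutators of actions, which are differences of
    [Q]. Both sides are twice the same alternating sum; this confirms the sign and scale of
    [schouten]. *)
Lemma rbracket_schouten a b c :
  bschouten rb rb a b c = trivector_op S (schouten r r) a b c.
Proof.
pose Q a b c := tlift (fun x y => tlift (fun z w =>
  D z (D x a) ** D y b ** D w c) r) r.
pose P a b c := tlift (fun x y => tlift (fun z w =>
  D (lie x z) a ** D y b ** D w c) r) r.
have rrb a' b' c' : rb (rb a' b') c' = Q a' b' c' - Q b' a' c'.
  have bQ : bilinear2 (fun x y => tlift (fun z w =>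
      D z (D x b') ** D y a' ** D w c') r).
    split=> [y|x] k u v; rewrite -tlift_linl; apply: eq_tlift => z w.
      by rewrite act_gen_linear act_linear !(amul_bilinear S).1.
    by rewrite act_gen_linear (amul_bilinear S).2 (amul_bilinear S).1.
  rewrite /Q -(tlift_skew r_skew bQ) -tliftD rbracketE.
  transitivity (tlift (fun z w => tlift (fun x y =>
      D z (D x a' ** D y b') ** D w c') r) r).
    apply: eq_tlift => z w; rewrite rbracketE (tlift_comp _ _ (act_linear _)).
    exact: (tlift_comp _ _ ((amul_bilinear S).1 (D w c'))).
  rewrite tlift_exchange; apply: eq_tlift => x y.
  rewrite -tliftD; apply: eq_tlift => z w.
  by rewrite act_gen_mul amulDl [D x a' ** _]amulC.
have PE a' b' c' : P a' b' c' = Q a' c' b' - Q a' b' c'.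
  (* Exchanging the two copies of [r] in the first [Q] reverses the order of its two actions, so
     that the difference becomes their commutator. *)
  rewrite /Q tlift_exchange -tliftN -tliftD; apply: eq_tlift => x y.
  rewrite -tliftN -tliftD; apply: eq_tlift => z w.
  rewrite act_lie !amulDl !amulNl; congr (_ - _).
  by rewrite -!amulA; congr (_ ** _); rewrite amulC.
(* The six terms of [wedge3] apply [x,z] to each argument twice; commutativity moves that factor to
   the front. *)
have TE : trivector_op S (schouten r r) a b c =
    - (P a b c + P c a b + P b c a - P b a c - P a c b - P c b a).
  have lt := trivector_op_linear a b c.
  rewrite /schouten (linear_opp lt) (tlift_comp _ _ lt).
  congr (- _); rewrite /P -!tliftN -!tliftD; apply: eq_tlift => x y.
  rewrite (tlift_comp _ _ lt) -!tliftN -!tliftD; apply: eq_tlift => z w.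
  rewrite /wedge3 !(linear_add lt) !(linear_opp lt) !trivector_op_pure.
  congr (_ + _ + _ - _ - _ - _).
  - by rewrite -[RHS]amulA [RHS]amulC.
  - by rewrite [RHS]amulC amulA.
  - by congr (_ ** _); rewrite amulC.
  - by rewrite -!amulA; congr (_ ** _); rewrite amulC.
  - by rewrite [RHS]amulC -amulA; congr (_ ** _); rewrite amulC.
rewrite TE /bschouten !rrb !PE !opprD !opprK !addrA.
by rewrite [RHS](ACl (2*5*9*8*6*3*7*12*4*1*11*10))%AC.
Qed.

End RMatrix.
End InvAlgebra.

(** * The formal parameter and low-order coefficients *)

Section PowerSeries.
Variable K : fieldType.

Definition hparam : {fps K} := Fps (fun n => (n == 1)%:R).

(** Division by h, exact when the constant coefficient vanishes. *)
Definition fshift (V : Type) (s : {fps V}) : {fps V} := Fps (fun n => s@_n.+1).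

Lemma fcoef_constZ (V : lmodType K) c (s : {fps V}) n :
  (c%:S *: s)@_n = c *: s@_n.
Proof. by apply: fconv_constl => v; rewrite scale0r. Qed.

Lemma hparamZ0 (V : lmodType K) (s : {fps V}) : (hparam *: s)@_0 = 0.
Proof. by rewrite fcoefZ big_ord1 scale0r. Qed.

Lemma hparamZS (V : lmodType K) (s : {fps V}) n : (hparam *: s)@_n.+1 = s@_n.
Proof.
rewrite fcoefZ !big_ord_recl scale0r add0r scale1r subSS subn0.
by rewrite big1 ?addr0 // => i _; rewrite scale0r.
Qed.

Lemma fshiftE (V : lmodType K) (s : {fps V}) :
  s = (s@_0)%:S + hparam *: fshift s.
Proof.
apply: fpsP => -[|n]; rewrite fcoefD ?hparamZ0 ?addr0 //.
by rewrite hparamZS add0r.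
Qed.

Lemma fconst_linear (V : lmodType K) c (u v : V) :
  (c *: u + v)%:S = c%:S *: u%:S + v%:S.
Proof.
apply: fpsP => n; rewrite fcoefD fcoef_constZ.
by case: n => [|n] //=; rewrite scaler0 addr0.
Qed.

Lemma hlift_coef1 (U V W : lmodType K) (F : U -> V -> {fps W}) s :
  (hlift F s)@_1 =
  tlift (fun u v => (F u v)@_1) s@_0 + tlift (fun u v => (F u v)@_0) s@_1.
Proof. by rewrite [LHS]big_ord_recr big_ord1. Qed.

End PowerSeries.

(** * The h-commutator and the Poisson bracket as its leading term *)

Section Quantization.
Variables (K : fieldType) (g : lieAlgType K) (A : lmodType K).
Variables (S : inv_algebra g A) (Ah : quantization S).
Local Notation "a ** b" := (amul S a b) (at level 40, left associativity).
Local Notation "s '*h' t" := (hmul Ah s t) (at level 40, left associativity).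

Definition hcomm (s t : {fps A}) : {fps A} := s *h t - t *h s.

Lemma hmulPl c s s' t : (c *: s + s') *h t = c *: (s *h t) + s' *h t.
Proof. exact: (hmul_bilinear Ah).1. Qed.
Lemma hmulPr c s t t' : s *h (c *: t + t') = c *: (s *h t) + s *h t'.
Proof. exact: (hmul_bilinear Ah).2. Qed.
Lemma hmulDl s s' t : (s + s') *h t = s *h t + s' *h t.
Proof. by rewrite -[s]scale1r hmulPl !scale1r. Qed.
Lemma hmulDr s t t' : s *h (t + t') = s *h t + s *h t'.
Proof. by rewrite -[t]scale1r hmulPr !scale1r. Qed.
Lemma hmul0l t : 0 *h t = 0.
Proof. by apply: (addIr (0 *h t)); rewrite -hmulDl !add0r. Qed.
Lemma hmul0r s : s *h 0 = 0.
Proof. by apply: (addIr (s *h 0)); rewrite -hmulDr !add0r. Qed.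
Lemma hmulZl c s t : (c *: s) *h t = c *: (s *h t).
Proof. by rewrite -[c *: s]addr0 hmulPl hmul0l addr0. Qed.
Lemma hmulZr c s t : s *h (c *: t) = c *: (s *h t).
Proof. by rewrite -[c *: t]addr0 hmulPr hmul0r addr0. Qed.
Lemma hmulNl s t : (- s) *h t = - (s *h t).
Proof. by rewrite -scaleN1r hmulZl scaleN1r. Qed.
Lemma hmulNr s t : s *h (- t) = - (s *h t).
Proof. by rewrite -scaleN1r hmulZr scaleN1r. Qed.

Lemma mu1_bilinear : bilinear2 (mu1 Ah).
Proof.
by split=> [d|d] c a b; rewrite /mu1 /= fconst_linear ?hmulPl ?hmulPr fcoefD
  fcoef_constZ.
Qed.

Lemma hcommDl s s' t : hcomm (s + s') t = hcomm s t + hcomm s' t.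
Proof. by rewrite /hcomm hmulDl hmulDr opprD addrACA. Qed.

Lemma hcommZl c s t : hcomm (c *: s) t = c *: hcomm s t.
Proof. by rewrite /hcomm hmulZl hmulZr scalerBr. Qed.

Lemma hcomm_leibniz s t u :
  hcomm (s *h t) u = s *h hcomm t u + hcomm s u *h t.
Proof.
rewrite /hcomm hmulDr hmulDl hmulNr hmulNl !hmulA addrA.
by rewrite subrK.
Qed.

Lemma hcomm_jacobi s t u :
  hcomm (hcomm s t) u + hcomm (hcomm t u) s + hcomm (hcomm u s) t = 0.
Proof.
rewrite /hcomm !(hmulDl, hmulDr, hmulNl, hmulNr) !hmulA !opprD !opprK !addrA.
rewrite [LHS](ACl (1*7*(12*2)*(9*3)*(4*6)*(5*11)*(8*10)))%AC /=.
by rewrite !subrr !addr0.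
Qed.

Lemma hcomm_coef0 s t : (hcomm s t)@_0 = 0.
Proof. by rewrite fcoefD fcoefN !hmul_mod amulC subrr. Qed.

(** Beyond its constant term [s] is a multiple of h, and every commutator is again divisible by h,
    so the rest of [s] contributes only from h^2 on. *)
Lemma hcomm_coef1_const s a : (hcomm s a%:S)@_1 = poisson Ah s@_0 a.
Proof.
rewrite [in LHS](fshiftE s) hcommDl hcommZl fcoefD hparamZS.
by rewrite hcomm_coef0 addr0 fcoefD fcoefN.
Qed.

Lemma hcomm_shift a b :
  hcomm a%:S b%:S = hparam K *: fshift (hcomm a%:S b%:S).
Proof.
by apply: fpsP => -[|n]; rewrite ?hcomm_coef0 ?hparamZ0 ?hparamZS.
Qed.

Lemma hcomm_shift_coef0 a b :
  (fshift (hcomm a%:S b%:S))@_0 = poisson Ah a b.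
Proof. exact: (hcomm_coef1_const a%:S b). Qed.

Lemma poisson_is_bracket : is_bracket S (poisson Ah).
Proof.
have [ml mr] := mu1_bilinear.
apply: is_bracket_skew => [d c a b|a b|a b c].
- by rewrite /poisson /= ml mr scalerBr opprD addrACA.
- by rewrite opprB.
(* Replacing ab by the constant coefficient of the deformed product allows the Leibniz identity of
   the commutator to be read off at order h. *)
have <- : (a%:S *h b%:S)@_0 = a ** b by rewrite hmul_mod.
rewrite -hcomm_coef1_const hcomm_leibniz (hcomm_shift b) (hcomm_shift a).
rewrite hmulZr hmulZl fcoefD !hparamZS !hmul_mod.
by rewrite !hcomm_shift_coef0.
Qed.

(** Each of the two nested commutators contributes one factor h, so this is the h^2 coefficient of
    the Jacobi identity for the h-commutator. *)
Lemma poisson_jacobi a b c :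
  poisson Ah (poisson Ah a b) c + poisson Ah (poisson Ah b c) a +
  poisson Ah (poisson Ah c a) b = 0.
Proof.
have E x y z : (hcomm (hcomm x%:S y%:S) z%:S)@_2 =
    poisson Ah (poisson Ah x y) z.
  rewrite hcomm_shift hcommZl hparamZS.
  by rewrite hcomm_coef1_const hcomm_shift_coef0.
by rewrite -!E -!fcoefD hcomm_jacobi.
Qed.

(** * The invariance of the quantization at order h *)

Section Invariance.
Variables (r : (g ⊗ g)%type) (Uh : quantum_group r).
Hypotheses (r_skew : tflip r = - r) (Ah_inv : quantum_invariant Uh Ah).

(** The factor h comes either from the product, with the undeformed coproduct acting, or from the
    coproduct, followed by the undeformed product. *)
Lemma mu1_act x a b : act S (uea_inj x) (mu1 Ah a b) =
  mu1 Ah (act S (uea_inj x) a) b + mu1 Ah a (act S (uea_inj x) b)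
  + biaction S (hcomul Uh (uea_inj x)%:S)@_1 a b.
Proof.
have := congr1 (fun s => s@_1) (Ah_inv (uea_inj x) a b).
rewrite /hact fconv_constl; last first.
  by move=> v; rewrite (linear_0 ((act_bilinear S).1 v)).
move=> ->; rewrite hlift_coef1.
have E i : (htact S (hcomul Uh (uea_inj x)%:S) (a ⊗ b)%:S)@_i =
    tact (act S) (hcomul Uh (uea_inj x)%:S)@_i (a ⊗ b).
  by apply: fconv_constr => T; rewrite (linear_0 (tact_linear S T)).
rewrite !E hcomul_mod tact_gen; congr (_ + _).
  rewrite (linear_add (tlift_linear mu1_bilinear)).
  by rewrite !(tlift_pure _ _ mu1_bilinear).
by rewrite -amul_tact; apply: eq_tlift => u v; rewrite hmul_mod.
Qed.

Lemma poisson_act x a b : act S (uea_inj x) (poisson Ah a b) =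
  poisson Ah (act S (uea_inj x) a) b + poisson Ah a (act S (uea_inj x) b)
  + biaction S (cobracket r x) a b.
Proof.
have lb := biaction_linear S a b.
rewrite -(hcomul_cobracket Uh) (linear_add lb) (linear_opp lb) biaction_flip.
rewrite /poisson (linear_add (act_linear S _)) (linear_opp (act_linear S _)).
rewrite !mu1_act !opprD addrACA; congr (_ + _).
by rewrite [RHS]addrACA; congr (_ + _); rewrite addrC.
Qed.

End Invariance.
End Quantization.

Theorem proposition2p2 (R : realType) (g : lieAlgType R[i])
    (g_semisimple : semisimple g)
    (r : (g ⊗ g)%type) (r_classical : classical_rmatrix r)
    (Uh : quantum_group r)
    (A : lmodType R[i]) (S : inv_algebra g A)
    (Ah : quantization S) (Ah_inv : quantum_invariant Uh Ah) :
  exists f : A -> A -> A,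
    [/\ is_bracket S f,
        inv_bracket S f,
        forall a b : A, poisson Ah a b = f a b - rbracket S r a b,
        compatible f (rbracket S r)
      & forall a b c : A,
          bschouten f f a b c = - trivector_op S (schouten r r) a b c].
Proof.
have [r_skew _] := r_classical.
have rb_br := rbracket_is_bracket S r_skew.
pose f a b := poisson Ah a b + rbracket S r a b.
have f_br : is_bracket S f by exact: is_bracketD (poisson_is_bracket Ah) rb_br.
have f_inv x a b : act S (uea_inj x) (f a b) =
    f (act S (uea_inj x) a) b + f a (act S (uea_inj x) b).
  rewrite (linear_add (act_linear S _)) (poisson_act Ah_inv) biaction_cobracket.
  by rewrite -addrA subrK addrACA.
have f_rb := rbracket_compatible r_skew f_br f_inv.
have [bf _ _ _] := f_br.
have [[lp _] _ _ _] := poisson_is_bracket Ah.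
exists f; split=> // [|a b|a b c]; first exact: inv_bracket_gen.
  by rewrite addrK.
have fE x y : f x y = poisson Ah x y + rbracket S r x y by [].
(* With [f] opaque, [fE] expands it only at the chosen occurrences. *)
clearbody f.
(* Obtained by expanding {{x,y},z} with {,} = f - {,}_r and solving for the term in [f] alone. *)
have ffE x y z : f (f x y) z = poisson Ah (poisson Ah x y) z
    + (f (rbracket S r x y) z + rbracket S r (f x y) z)
    - rbracket S r (rbracket S r x y) z.
  rewrite fE {1}(fE x y) (linear_add (lp z)) (fE (rbracket S r x y)).
  by rewrite !addrA [RHS]addrAC addrK.
have ff_sum : f (f a b) c + f (f b c) a + f (f c a) b =
    - (rbracket S r (rbracket S r a b) c + rbracket S r (rbracket S r b c) a
       + rbracket S r (rbracket S r c a) b).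
  rewrite !ffE.
  (* The cyclic sum is regrouped into the Jacobi sum of {,}, the Schouten bracket of [f] with {,}_r,
     and the pure r-matrix terms; the first two groups vanish. *)
  rewrite [LHS](AC ((1*2*1)*(1*2*1)*(1*2*1))
    ((1*5*9)*((2*3)*(6*7)*(10*11))*(4*8*12)))%AC /=.
  by rewrite poisson_jacobi [X in 0 + X](f_rb a b c) !add0r !opprD.
rewrite -rbracket_schouten // /bschouten.
(* In the Schouten bracket of a bracket with itself every term occurs twice, so each side splits
   into two equal cyclic sums. *)
rewrite [LHS](AC (2*2*2) ((1*3*5)*(2*4*6)))%AC /= ff_sum -opprD; congr (- _).
by rewrite [RHS](AC (2*2*2) ((1*3*5)*(2*4*6)))%AC.
Qed.
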